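(* Let $\pi:E\to[n]$ be a surjection from a finite set $E$ with $|\pi^{-1}(i)|\ge2$ for every $i$, and let $S\subseteq E$ be a nonempty $\pi$-colored set. The outward-support coefficients of $e_S+(-\mathsf F_S)$ restrict to $\mathrm h_S^\pi$. Equivalently, $$-h(\mathsf F_S-e_S,e_R)=\mathrm h_S^\pi(e_R)$$ for every nonempty $\pi$-colored set $R\subseteq E$.
   Context: Put $E_i=\pi^{-1}(i)$. For $T\subseteq E$, $e_T=\sum_{s\in T}e_s\in\mathbb R^E$. A set $S\subseteq E$ is $\pi$-colored if $|S\cap E_i|\le1$ for every $i$. For nonempty $\pi$-colored sets $S,R$, $\mathrm h_S^\pi(e_R)=1$ if $S\cap R\ne\emptyset$ and $0$ otherwise. (The vectors $e_R$ generate the rays of the $\pi$-colored fan, whose cones are $\operatorname{Cone}(e_{S_1},\dots,e_{S_k})$ for chains $S_1\subsetneq\dots\subsetneq S_k$ of nonempty $\pi$-colored sets, taken modulo $\operatorname{Span}\{e_{E_1},\dots,e_{E_n}\}$.) Support functions are $h(\mathsf Q,u)=\min_{x\in\mathsf Q}u\cdot x$; the outward support function is $h_{\max}(\mathsf Q,u)=\max_{x\in\mathsf Q}u\cdot x$, so $h_{\max}(-\mathsf Q,u)=-h(\mathsf Q,u)$; its values at the $e_R$ are the outward-support coefficients. For a nonempty $\pi$-colored $S$ let $I(S)=\{i : S\cap E_i\neq\emptyset\}$, $\mathbf E_S=(E_i)_{i\in I(S)}$, and $\Delta(\mathbf E_S)=\prod_{i\in I(S)}\operatorname{conv}\{e_s:s\in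 E_i\}\subset\mathbb R^E$ (zero in the other coordinates). The point $e_S$ is a vertex of $\Delta(\mathbf E_S)$, and $\mathsf F_S=\operatorname{Fr}[\Delta(\mathbf E_S),\{e_S\}]$ is the fragment of this vertex: $$\mathsf F_S=\Big\{x\in\Delta(\mathbf E_S) : \sum_{i\in I(S)}\ \sum_{t\in E_i\setminus S}x(t)\le1\Big\},$$ equivalently the convex hull of $e_S$ and the vertices of $\Delta(\mathbf E_S)$ adjacent to it. *)

(* Defs.v *)
From HB Require Import structures.
From mathcomp Require Import all_boot all_order all_algebra.
From mathcomp Require Import boolp classical_sets reals convex.

Set Implicit Arguments.
Unset Strict Implicit.
Unset Printing Implicit Defensive.

Import Order.TTheory GRing.Theory Num.Theory.

Local Open Scope classical_set_scope.
Local Open Scope ring_scope.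

(* {set _} and the operations with a colon (:&:, :\:, @^-1:) are finite sets
   (subsets of E); set _ is a classical set (a subset of R^E). *)

Section Colored.
Variables (E : finType) (n : nat) (pi : E -> 'I_n).

Definition fiber (i : 'I_n) : {set E} := pi @^-1: [set i]%SET.

Definition colored (S : {set E}) : Prop :=
  forall i, (#|S :&: fiber i| <= 1)%N.

Definition color_support (S : {set E}) : {set 'I_n} :=
  [set i | S :&: fiber i != finset.set0]%SET.

End Colored.

(* R^o is R as a module over itself, so that R^E below is an lmodType R. *)
Definition vec (R : realType) (E : finType) := {ffun E -> R^o}.

Section Vectors.
Variables (R : realType) (E : finType).
Implicit Types (u x : vec R E) (T : {set E}) (Q : set (vec R E)).

Definition dot u x : R := \sum_(s : E) u s * x s.

Definition evec T : vec R E := [ffun s => (s \in T)%:R].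

Definition coord_proj T x : vec R E := [ffun s => if s \in T then x s else 0].

Definition conv_hull Q : set (vec R E) := smallest (@convex_set R _) Q.

Definition is_min (A : set R) (m : R) : Prop := A m /\ lbound A m.
Definition is_max (A : set R) (m : R) : Prop := A m /\ ubound A m.

(* The graphs of the support functions: m = h(Q, u) and m = h_max(Q, u).
   As relations they also assert that the extremum is attained. *)
Definition is_support Q u (m : R) : Prop := is_min [set dot u x | x in Q] m.
Definition is_outer_support Q u (m : R) : Prop :=
  is_max [set dot u x | x in Q] m.

End Vectors.

Section Fragment.
Variables (R : realType) (E : finType) (n : nat) (pi : E -> 'I_n).
Implicit Types (S T : {set E}).

(* x lies in the product over i in I(S) of the simplices conv{e_s : s in E_i}:
   its E_i-block lies in the i-th factor, embedded in R^E by zero, and the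
   coordinates outside these blocks vanish. *)
Definition simplex_product S : set (vec R E) :=
  [set x | (forall i, i \in color_support pi S ->
              conv_hull [set evec R [set s]%SET | s in [set` fiber pi i]]
                (coord_proj (fiber pi i) x)) /\
           (forall s, pi s \notin color_support pi S -> x s = 0)].

Definition fragment S : set (vec R E) :=
  [set x | simplex_product S x /\
           \sum_(i in color_support pi S) \sum_(t in fiber pi i :\: S) x t <= 1].

(* The value of h_S^pi at the ray generator e_T. *)
Definition colored_h S T : R := if S :&: T != finset.set0 then 1 else 0.

End Fragment.

Arguments simplex_product R {E n} pi S _.
Arguments fragment R {E n} pi S _.

(* Main.v *)
Require Import Defs.
From HB Require Import structures.
From mathcomp Require Import all_boot all_order all_algebra.
From mathcomp Require Import boolp classical_sets reals interval_inference convex.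

Set Implicit Arguments.
Unset Strict Implicit.
Unset Printing Implicit Defensive.

Import Order.TTheory GRing.Theory Num.Theory.

Local Open Scope classical_set_scope.
Local Open Scope ring_scope.

(** For $x \in \mathsf F_S$ the number to be maximized is
    $e_T \cdot (e_S - x) = \sum_{s \in S \cap T} (1 - x(s)) -
    \sum_{t \in T \setminus S} x(t)$.
    As $x \ge 0$, it is at most $\sum_{s \in S \cap T} (1 - x(s))$.  Since $S$
    meets each block $E_i$, $i \in I(S)$, in a single point and $x$ has
    coordinate sum $1$ on $E_i$, the deficit of $x$ at the point of $S$ in
    $E_i$ is the mass of $x$ on $E_i \setminus S$.  The defining inequality
    of the fragment bounds the total of these masses by $1$, which gives the
    upper bound $\mathrm h_S^\pi(e_T)$, the sum over $S \cap T$ being empty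
    when that set is ([dot_gap_le]).

    If $S \cap T$ is empty, the bound $0$ is attained at $e_S$.  Otherwise pick
    $s \in S \cap T$ and another point $t$ of the block of $s$: the vertex of
    $\Delta(\mathbf E_S)$ obtained from $e_S$ by exchanging $s$ for $t$ is
    adjacent to $e_S$, hence in the fragment, and the value there is $1$,
    because $t \notin T$ when $T$ is colored ([dot_gap_attained]). *)

(** * Coordinates and the standard simplex *)

Lemma dot_evecl (R : realType) (E : finType) (T : {set E}) (x : vec R E) :
  dot (evec R T) x = \sum_(s in T) x s.
Proof.
rewrite /dot [RHS]big_mkcond; apply: eq_bigr => s _.
by rewrite ffunE; case: (s \in T); rewrite ?mul1r ?mul0r.
Qed.

Lemma dotrN (R : realType) (E : finType) (u x : vec R E) :
  dot u (- x) = - dot u x.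
Proof.
by rewrite /dot -sumrN; apply: eq_bigr => s _; rewrite ffunE mulrN.
Qed.

Lemma coord_proj_evec (R : realType) (E : finType) (F U : {set E}) :
  coord_proj F (evec R U) = evec R (U :&: F)%SET.
Proof.
by apply/ffunP => s; rewrite !ffunE finset.in_setI andbC; case: (s \in F).
Qed.

(** Only this inclusion of the convex hull in the standard simplex is needed:
    both conditions cut out a convex set that contains the generators. *)
Lemma conv_hull_evec1 (R : realType) (E : finType) (F : {set E}) (x : vec R E) :
  conv_hull [set evec R [set s]%SET | s in [set` F]] x ->
  (forall s, 0 <= x s) /\ \sum_(s in F) x s = 1.
Proof.
pose D : set (vec R E) :=
  [set y | (forall s, 0 <= y s) /\ \sum_(s in F) y s = 1].
suff DP : conv_hull [set evec R [set s]%SET | s in [set` F]] `<=` D.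
  by move/DP.
apply: smallest_sub; last first.
  move=> _ /= [s sF <-]; split=> [t|]; first by rewrite ffunE ler0n.
  rewrite (bigD1 s) //= big1 ?addr0 => [|t /andP[_ ts]].
    by rewrite ffunE set11.
  by rewrite ffunE finset.in_set1 (negbTE ts).
move=> y z l /set_mem[y0 y1] /set_mem[z0 z1]; apply/mem_set.
have convE s : (conv l (y : convex_lmodType (vec R E)) z : vec R E) s
    = l%:num * y s + (1 - l%:num) * z s.
  by rewrite !ffunE.
split=> [s|].
  by rewrite convE addr_ge0 // mulr_ge0 // subr_ge0.
under eq_bigr do rewrite convE.
by rewrite big_split /= -!mulr_sumr y1 z1 !mulr1 subrKC.
Qed.

(** * The product of simplices and its vertices *)

Lemma colored_fiber (E : finType) (n : nat) (pi : E -> 'I_n) (U : {set E})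
    (i : 'I_n) : colored pi U -> i \in color_support pi U ->
  exists s, (U :&: fiber pi i)%SET = [set s]%SET.
Proof.
move=> Ucol; rewrite inE -card_gt0 => Ui.
by apply/cards1P; rewrite eqn_leq Ucol.
Qed.

Lemma mem_color_support (E : finType) (n : nat) (pi : E -> 'I_n) (U : {set E})
    (s : E) : s \in U -> pi s \in color_support pi U.
Proof.
by move=> sU; rewrite inE; apply/set0Pn; exists s; rewrite !inE sU eqxx.
Qed.

Lemma colored_inj (E : finType) (n : nat) (pi : E -> 'I_n) (U : {set E}) :
  colored pi U -> {in U &, injective pi}.
Proof.
move=> Ucol s t sU tU st; have /card_le1_eqP := Ucol (pi t).
by apply; rewrite !inE ?sU ?tU ?st eqxx.
Qed.

Section SimplexProduct.
Variables (R : realType) (E : finType) (n : nat) (pi : E -> 'I_n).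
Implicit Types (S T U : {set E}) (x : vec R E).

Lemma simplex_product_ge0 S x s : simplex_product R pi S x -> 0 <= x s.
Proof.
case=> xI x0; have [sI|/x0 -> //] := boolP (pi s \in color_support pi S).
have [/(_ s) + _] := conv_hull_evec1 (xI _ sI).
by rewrite ffunE !inE eqxx.
Qed.

Lemma simplex_product_sum S x i : simplex_product R pi S x ->
  i \in color_support pi S -> \sum_(s in fiber pi i) x s = 1.
Proof.
case=> xI _ /xI/conv_hull_evec1[_ <-].
by apply: eq_bigr => s si; rewrite ffunE si.
Qed.

Lemma simplex_product_evec S U : colored pi U ->
  color_support pi U = color_support pi S -> simplex_product R pi S (evec R U).
Proof.
move=> Ucol US; split=> [i|s sI].
  rewrite -US => iU; have [s sE] := colored_fiber Ucol iU.
  rewrite coord_proj_evec sE; apply: sub_smallest (@subset_refl _ _) _ _.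
  exists s => //=.
  by have := set11 s; rewrite -sE => /setIP[].
rewrite ffunE; case: (boolP (s \in U)) sI => // /(mem_color_support pi).
by rewrite US => ->.
Qed.

(** The points $e_U$ with $|U \setminus S| \le 1$ are $e_S$ and the vertices
    adjacent to it: the mass of $e_U$ outside $S$ is at most
    $|U \setminus S|$. *)
Lemma fragment_evec S U : colored pi U ->
  color_support pi U = color_support pi S -> (#|U :\: S| <= 1)%N ->
  fragment R pi S (evec R U).
Proof.
move=> Ucol US cardU; split; first exact: simplex_product_evec.
have fiberE (i : 'I_n) : i \in color_support pi S ->
    \sum_(t in fiber pi i :\: S) evec R U t
    = \sum_(t in U :\: S | pi t == i) 1 :> R.
  move=> _; rewrite [LHS]big_mkcond [RHS]big_mkcond; apply: eq_bigr => t _.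
  by rewrite ffunE !inE; case: (t \in S); case: (t \in U); case: (pi t == i).
rewrite (eq_bigr _ fiberE) -(partition_big pi) /=; last first.
  by move=> t /setDP[tU _]; rewrite -US; apply: mem_color_support.
by rewrite sumr_const lern1.
Qed.

(** * The value on the fragment *)

(** The total deficit of $x$ at the points of $S$ is its mass outside $S$. *)
Lemma simplex_product_deficit S x : colored pi S -> simplex_product R pi S x ->
  \sum_(s in S) (1 - x s)
  = \sum_(i in color_support pi S) \sum_(t in fiber pi i :\: S) x t.
Proof.
move=> Scol xS.
rewrite (partition_big pi (mem (color_support pi S))) /=; last first.
  by move=> s; apply: mem_color_support.
apply: eq_bigr => i iS; have [s sE] := colored_fiber Scol iS.
have := simplex_product_sum xS iS; rewrite (big_setID S) /= finset.setIC sE.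
rewrite big_set1 => <-; rewrite (big_pred1 s) => [|t].
  by rewrite [LHS]addrC; exact: addKr.
by have /setP/(_ t) := sE; rewrite !inE.
Qed.

Lemma dot_gap_le S T x : colored pi S -> fragment R pi S x ->
  dot (evec R T) (evec R S - x) <= colored_h R S T.
Proof.
move=> Scol [xS xle1]; have x0 s := simplex_product_ge0 s xS.
rewrite dot_evecl (big_setID S) /=.
under eq_bigr => s /setIP[_ sS] do rewrite !ffunE sS /=.
have out_le0 : \sum_(s in T :\: S) (evec R S - x) s <= 0.
  apply: sumr_le0 => s /setDP[_ sS].
  by rewrite !ffunE (negbTE sS) sub0r oppr_le0.
rewrite -[leRHS]addr0; apply: lerD out_le0.
rewrite /colored_h finset.setIC; case: ifPn => [_|]; last first.
  by rewrite negbK => /eqP ->; rewrite big_set0.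
apply: le_trans xle1; rewrite -simplex_product_deficit //.
rewrite [leRHS](big_setID T) /= lerDl sumr_ge0 // => s /setDP[sS _].
have sI := mem_color_support pi sS.
rewrite -(simplex_product_sum xS sI) (bigD1 s) /=; last by rewrite !inE.
by rewrite addrC addrK sumr_ge0.
Qed.

Lemma dot_gap_attained S T : (forall i, (2 <= #|fiber pi i|)%N) ->
  colored pi S -> colored pi T ->
  exists2 x, fragment R pi S x & dot (evec R T) (evec R S - x) = colored_h R S T.
Proof.
move=> fiber_ge2 Scol Tcol; rewrite /colored_h.
case: ifPn => [/set0Pn[s /setIP[sS sT]]|_]; last first.
  exists (evec R S); first by apply: fragment_evec; rewrite ?finset.setDv ?cards0.
  by rewrite subrr dot_evecl big1 // => s _; rewrite ffunE.
have [t ts tF] : exists2 t, t != s & pi t = pi s.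
  have : (0 < #|fiber pi (pi s) :\ s|)%N.
    by have := fiber_ge2 (pi s); rewrite (cardsD1 s) !inE eqxx.
  by case/card_gt0P => t; rewrite !inE => /andP[ts /eqP ?]; exists t.
have tS : t \notin S.
  by apply: contra ts => tS; apply/eqP/(colored_inj Scol).
have tT : t \notin T.
  by apply: contra ts => tT; apply/eqP/(colored_inj Tcol).
pose U := (t |: (S :\ s))%SET.
(* Exchanging s for t changes no color count, as both have the same color. *)
have cardU i : #|(U :&: fiber pi i)%SET| = #|(S :&: fiber pi i)%SET|.
  rewrite finset.setIUl finset.setIDAC.
  have [<-|si] := eqVneq (pi s) i.
    rewrite (finset.setIidPl _) ?finset.sub1set ?inE ?tF // cardsU1 !inE
      (negbTE tS) andbF.
    by rewrite [RHS](cardsD1 s) !inE sS eqxx.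
  have -> : ([set t] :&: fiber pi i = finset.set0)%SET.
    by apply/setP => r; rewrite !inE; case: eqVneq => // ->; rewrite tF (negbTE si).
  by rewrite finset.set0U [RHS](cardsD1 s) !inE (negbTE si) andbF.
exists (evec R U).
  apply: fragment_evec.
  - by move=> i; rewrite cardU.
  - by apply/setP => i; rewrite !inE -!card_gt0 cardU.
  rewrite -(cards1 t); apply/subset_leq_card/fintype.subsetP => r.
  by rewrite !inE; case: (r == t) => //=; case: (r \in S); rewrite ?andbF.
rewrite dot_evecl (bigD1 s) //= big1 => [|r /andP[rT rs]].
  by rewrite !ffunE !inE sS eqxx eq_sym (negbTE ts) subr0 addr0.
have rt : r != t by apply: contraNneq tT => <-.
by rewrite !ffunE !inE rs (negbTE rt) subrr.
Qed.

End SimplexProduct.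

Theorem proposition8p8 (R : realType) (E : finType) (n : nat) (pi : E -> 'I_n)
    (pi_surj : forall i : 'I_n, exists s : E, pi s = i)
    (fiber_ge2 : forall i : 'I_n, (2 <= #|fiber pi i|)%N)
    (S : {set E}) (S_neq0 : S != finset.set0) (S_colored : colored pi S) :
  forall T : {set E}, T != finset.set0 -> colored pi T ->
    is_outer_support
      [set evec R S + y | y in [set - x | x in fragment R pi S]]
      (evec R T) (colored_h R S T)
    /\
    (exists2 m : R,
       is_support [set x - evec R S | x in fragment R pi S] (evec R T) m &
       - m = colored_h R S T).
Proof.
move=> T _ Tcol.
have le_h x := @dot_gap_le R E n pi S T x S_colored.
have [x xF xE] := dot_gap_attained R fiber_ge2 S_colored Tcol.
split.
  split=> [|_ [_ [_ [y yF <-] <-] <-]]; last exact: le_h.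
  by exists (evec R S - x) => //; exists (- x) => //; exists x.
exists (- colored_h R S T); last by rewrite opprK.
have dotC y : dot (evec R T) (y - evec R S) = - dot (evec R T) (evec R S - y).
  by rewrite -dotrN opprB.
split=> [|_ [_ [y yF <-] <-]].
  by exists (x - evec R S); [exists x | rewrite dotC xE].
by rewrite dotC lerN2 le_h.
Qed.
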